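(* For integers $m,n\ge 1$, let $\mathrm{King}_{m,n}$ be the $m\times n$ king graph and let $\mathcal{R}$ denote the representation number. Then $\mathcal{R}(\mathrm{King}_{m,n})$ is finite for all $m,n\ge 1$, and moreover: \begin{itemize} \item $\mathcal{R}(\mathrm{King}_{m,n})=1$ for $m,n\in\{1,2\}$; \item $\mathcal{R}(\mathrm{King}_{m,n})=2$ for $m\in\{1,2\}$ and all $n\ge 3$; \item $\mathcal{R}(\mathrm{King}_{m,n})=2$ for $m\in\{3,4\}$ and $n\in\{1,2\}$; \item $\mathcal{R}(\mathrm{King}_{m,n})=3$ for $m\in\{3,4\}$ and all $n\ge 3$. \end{itemize}
   Context: All graphs are finite, simple and undirected. Two distinct letters $x,y$ alternate in a word $w$ if deleting from $w$ all letters other than $x$ and $y$ leaves a word of the form $xyxy\cdots$ or $yxyx\cdots$ (of even or odd length). A word $w$ over the alphabet $V$, in which every letter of $V$ occurs, represents a graph $G=(V,E)$ if for all distinct $x,y\in V$: $x$ and $y$ alternate in $w$ if and only if $(x,y)\in E$. $G$ is word-representable if some word represents it. $G$ is $k$-representable if it is represented by a word in which each letter appears exactly $k$ times. The representation number $\mathcal{R}(G)$ is the smallest integer $k\ge 1$ such that $G$ is $k$-representable; $\mathcal{R}(G)=\infty$ if $G$ is not word-representable. (Every word-representable graph is $k$-representable for some $k$.) The king graph $\mathrm{King}_{m,n}$ has vertex set $\{x_{i,j}: 1\le i\le m,\ 1\le j\le n\}$, and two distinct vertices $x_{a,b}$, $x_{c,d}$ are adjacent if and only if $|a-c|\le 1$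 and $|b-d|\le 1$. *)

(* Defs.v *)
From mathcomp Require Import all_boot all_order all_algebra.
From mathcomp Require Import boolp.

Set Implicit Arguments.
Unset Strict Implicit.
Unset Printing Implicit Defensive.

Record sgraph := SGraph {
  vertex :> finType;
  edge : rel vertex;
  edge_sym : symmetric edge;
  edge_irrefl : irreflexive edge }.

(* The word x y x y ... of length n. *)
Definition altword (T : Type) (x y : T) (n : nat) : seq T :=
  mkseq (fun i => if odd i then y else x) n.

Definition alternate (T : eqType) (x y : T) (w : seq T) : Prop :=
  exists n : nat, let w' := [seq z <- w | (z == x) || (z == y)] in
  w' = altword x y n \/ w' = altword y x n.

Definition represents (G : sgraph) (w : seq G) : Prop :=
  (forall x : G, x \in w) /\
  (forall x y : G, x != y -> (alternate x y w <-> edge x y)).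

Definition word_representable (G : sgraph) : Prop :=
  exists w : seq G, represents w.

Definition k_representable (k : nat) (G : sgraph) : Prop :=
  exists w : seq G, represents w /\ forall x : G, count_mem x w = k.

(* [None] stands for infinity.  It is the value when no k >= 1 works; every
   word-representable graph being k-representable for some k, this happens
   exactly when G is not word-representable. *)
Definition representation_number (G : sgraph) : option nat :=
  if pselect (exists k, (1 <= k) && `[< k_representable k G >]) is left exk
  then Some (ex_minn exk) else None.

Lemma representation_numberP (G : sgraph) (k : nat) :
  representation_number G = Some k <->
  [/\ 1 <= k, k_representable k G &
      forall j, 1 <= j -> k_representable j G -> k <= j].
Proof.
rewrite /representation_number; case: pselect => [exk|nexk]; last first.
  split=> // -[k1 kG _]; case: nexk; exists k.
  by rewrite k1; apply/asboolP.
case: ex_minnP => i /andP[i1 /asboolP iG] imin; split=> [[<-]|[k1 kG kmin]].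
  by split=> // j j1 jG; apply: imin; rewrite j1; apply/asboolP.
congr Some; apply/eqP; rewrite eqn_leq kmin // andbT.
by apply: imin; rewrite k1; apply/asboolP.
Qed.

Lemma representation_number_infinite (G : sgraph) :
  ~ word_representable G -> representation_number G = None.
Proof.
case E: representation_number => [k|//] nG; case: nG.
by have [_ [w [wG _]] _] := (representation_numberP G k).1 E; exists w.
Qed.

(* Indices run over 0 .. m-1 and 0 .. n-1; `|a - c|%N is the absolute
   difference, the subtraction being that of integers. *)
Definition king_edge (m n : nat) : rel ('I_m * 'I_n) :=
  fun u v => [&& u != v, `|u.1 - v.1|%N <= 1 & `|u.2 - v.2|%N <= 1].

Lemma king_edge_sym (m n : nat) : symmetric (@king_edge m n).
Proof.
by move=> u v; rewrite /king_edge eq_sym; congr [&& _, _ <= _ & _ <= _];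
  rewrite distnC.
Qed.

Lemma king_edge_irrefl (m n : nat) : irreflexive (@king_edge m n).
Proof. by move=> u; rewrite /king_edge eqxx. Qed.

Definition King (m n : nat) : sgraph :=
  SGraph (@king_edge_sym m n) (@king_edge_irrefl m n).

(* Main.v *)
(**
Place the copies of the letters of a k-uniform word at integer positions, the
copy number c of the letter x at [f x c]; two letters alternate iff their
position sequences interleave.  All upper bounds are given by such positions.

Finiteness: orient the edges of a king graph from lower to higher colour, where
the parities (row, column) receive the colours (even, even) < (even, odd) <
(odd, odd) < (odd, even).  A directed path has at most four vertices, and if
the ends of a four-vertex path are adjacent then the four vertices form a
2 x 2 square, hence a clique.  So the orientation is semi-transitive, and graphs with a
semi-transitive orientation are word-representable.

Upper bound 3: two adjacent columns are given a fixed pattern of 24 positions,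
which is translated along the board in four sweeps, alternately from left to
right and from right to left.

Lower bounds: a 1-uniform word only represents a complete graph.  For 2-uniform
words, seven of the nine vertices of the 3 x 3 king graph are already
contradictory: inserting the letters one after the other in all possible ways
leaves at most 40 words at each stage, and none at the end.
*)
Require Import Defs.
From mathcomp Require Import all_boot all_algebra zify.

Set Implicit Arguments.
Unset Strict Implicit.
Unset Printing Implicit Defensive.

(** * Words from positions *)

Section Alternation.
Variable T : eqType.
Implicit Types (x y z : T) (w : seq T).

(* [w] restricted to [x] and [y] alternates and does not begin with [y]. *)
Definition leads x y w :=
  forall i, count_mem y (take i w) <= count_mem x (take i w)
            <= (count_mem y (take i w)).+1.

Lemma filter2C x y w :
  [seq z <- w | (z == x) || (z == y)] = [seq z <- w | (z == y) || (z == x)].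
Proof. by apply: eq_filter => u; rewrite orbC. Qed.

Lemma altwordS x y n : altword x y n.+1 = x :: altword y x n.
Proof.
rewrite /altword /mkseq /= -[1]addn0 iotaDl -map_comp; congr (_ :: _).
by apply: eq_map => i /=; rewrite add0n; case: (odd i).
Qed.

(** Induction on [w]: removing a leading [x] exchanges the roles of the two letters, and the
    inequalities of [leads x y] become those of [leads y x]. *)
Lemma altwordP x y w : x != y ->
  (exists n, [seq z <- w | (z == x) || (z == y)] = altword x y n) <-> leads x y w.
Proof.
elim: w x y => [|z w IHw] x y nxy.
  by split=> [_ i //|_]; exists 0.
have [zx|nzx] := eqVneq z x.
  rewrite zx /= eqxx /=; have nyx : y != x by rewrite eq_sym.
  have [IH1 IH2] := IHw y x nyx.
  split=> [[[|n]]|L].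
  - by [].
  - rewrite altwordS filter2C => -[e] [|i] //=.
    have := IH1 (ex_intro _ n e) i; rewrite eqxx (negbTE nxy) /=; lia.
  - case: IH2 => [i|n e]; last by exists n.+1; rewrite altwordS filter2C e.
    by have := L i.+1; rewrite /= eqxx (negbTE nxy) /=; lia.
have [zy|nzy] := eqVneq z y.
  rewrite zy /= eqxx orbT; split=> [[[|n]]|L] //.
    by rewrite altwordS => -[e]; rewrite e eqxx in nxy.
  by have := L 1; rewrite /= take0 /= eqxx eq_sym (negbTE nxy).
rewrite /= (negbTE nzx) (negbTE nzy) /=; have [IH1 IH2] := IHw x y nxy.
split=> [/IH1 L [|i] //=|L]; first by rewrite (negbTE nzx) (negbTE nzy) !add0n.
by apply: IH2 => i; have := L i.+1; rewrite /= (negbTE nzx) (negbTE nzy) !add0n.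
Qed.

Lemma alternateP x y w : x != y ->
  alternate x y w <-> leads x y w \/ leads y x w.
Proof.
move=> nxy; have nyx : y != x by rewrite eq_sym.
rewrite -!altwordP // /alternate /= -(filter2C x y).
by split=> [[n [e|e]]|[[n e]|[n e]]]; [left|right| |]; exists n; auto.
Qed.

Lemma size_altword x y n : size (altword x y n) = n.
Proof. exact: size_mkseq. Qed.

End Alternation.

Lemma map_altword (S T : Type) (h : S -> T) (x y : S) n :
  map h (altword x y n) = altword (h x) (h y) n.
Proof.
by rewrite /altword /mkseq -map_comp; apply: eq_map => i /=; case: (odd i).
Qed.

Definition interleaved (k : nat) (a b : nat -> nat) :=
  forall c, c < k -> a c < b c /\ (c.+1 < k -> b c < a c.+1).

Section Keys.
Variables (T : finType) (k : nat) (f : T -> nat -> nat).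
Hypothesis f_incr : forall x c d, c < d -> d < k -> f x c < f x d.
Hypothesis f_neq : forall x y c d, x != y -> c < k -> d < k -> f x c <> f y d.

(** Positions need not be consecutive: an unoccupied one yields [None], which [pmap] discards. *)
Definition key_letter (n : nat) : option T :=
  [pick x | [exists c : 'I_k, f x c == n]].

Definition key_bound := \max_(p : T * 'I_k) (f p.1 p.2).+1.

Definition key_word : seq T := pmap key_letter (iota 0 key_bound).

Lemma f_inj x c d : c < k -> d < k -> f x c = f x d -> c = d.
Proof.
move=> ck dk e; case: (ltngtP c d) => // [cd|dc].
  by have := f_incr x cd dk; rewrite e ltnn.
by have := f_incr x dc ck; rewrite e ltnn.
Qed.

Lemma key_letterP x n :
  reflect (exists2 c, c < k & f x c = n) (key_letter n == Some x).
Proof.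
apply: (iffP eqP); rewrite /key_letter; case: pickP => //.
- by move=> y /existsP[c /eqP e] [<-]; exists c.
- move=> y /existsP[c /eqP e] [d dk e'].
  case: (eqVneq y x) => [->//|nyx].
  by have := f_neq nyx (ltn_ord c) dk; rewrite e e'.
- move=> n0 [d dk e]; have /negP[] := negbT (n0 x).
  by apply/existsP; exists (Ordinal dk); rewrite /= e.
Qed.

Definition key_count x n := count_mem x (pmap key_letter (iota 0 n)).

Lemma key_countS x n :
  key_count x n.+1 = key_count x n + (key_letter n == Some x).
Proof.
rewrite /key_count -addn1 iotaD pmap_cat count_cat /= add0n; congr (_ + _).
by case: (key_letter n) => [y|] //=; rewrite addn0.
Qed.

(** Positions of [x] increase, so the copies below [n] are an initial segment of the indices and
    their number is known from its strict lower bounds. *)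
Lemma key_countP x n c : (c < key_count x n) = (c < k) && (f x c < n).
Proof.
elim: n c => [|n IHn] c; first by rewrite ltn0 andbF.
rewrite key_countS; have le_k : key_count x n <= k.
  by rewrite leqNgt IHn ltnn.
case: key_letterP => [[d dk e]|nd].
  have dE : key_count x n = d.
    apply/eqP; rewrite eqn_leq leqNgt IHn e ltnn andbF /=.
    case: d => // d in dk e *.
    by rewrite IHn (ltn_trans (ltnSn d) dk) -e; apply: f_incr.
  rewrite addn1 ltnS leq_eqVlt IHn dE.
  have [->|ncd] /= := eqVneq c d; first by rewrite e dk ltnSn.
  case: (ltnP c k) => //= ck; rewrite ltnS [RHS]leq_eqVlt.
  by have [ec|//] := eqVneq (f x c) n; case/eqP: ncd;
    exact: (@f_inj x _ _ ck dk (etrans ec (esym e))).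
rewrite addn0 IHn; case: (ltnP c k) => //= ck; rewrite ltnS [RHS]leq_eqVlt.
by have [ec|//] := eqVneq (f x c) n; case: nd; exists c.
Qed.

Lemma key_count_max x : key_count x key_bound = k.
Proof.
have lb c : c < k -> f x c < key_bound.
  by move=> ck; rewrite /key_bound (bigmax_sup (x, Ordinal ck)).
apply/eqP; rewrite eqn_leq leqNgt key_countP ltnn /=.
case: {2 3}k (erefl k) => // k' kE; rewrite key_countP kE ltnSn /= lb //.
by rewrite kE.
Qed.

(** Prefixes of [key_word] are the same as words of initial segments of positions, so counts may be
    taken at positions. *)
Lemma leads_key_word x y :
  leads x y key_word <->
  (forall n, n <= key_bound ->
     key_count y n <= key_count x n <= (key_count y n).+1).
Proof.
split=> [L n nb|C i].
  have := L (size (pmap key_letter (iota 0 n))).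
  by rewrite /key_word -(subnKC nb) iotaD pmap_cat take_size_cat.
suff [n nb ->] : exists2 n, n <= key_bound &
    take i key_word = pmap key_letter (iota 0 n) by exact: C.
rewrite /key_word; elim: key_bound => [|n [m mn e]]; first by exists 0.
have [le|lt] := leqP i (size (pmap key_letter (iota 0 n))).
  exists m; first exact: leqW.
  by rewrite -addn1 iotaD pmap_cat takel_cat.
exists n.+1 => //; rewrite take_oversize //; apply: leq_trans lt.
rewrite -addn1 iotaD pmap_cat size_cat /= -addn1 leq_add2l.
by case: (key_letter _).
Qed.

Lemma leads_interleaved x y : x != y ->
  leads x y key_word <-> interleaved k (f x) (f y).
Proof.
move=> nxy; rewrite leads_key_word; split=> [C c ck|I n _].
  (* Across position [f y c] the count of [y] goes from [c] to [c.+1] while that of [x] is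
     unchanged; the bounds on both sides force the latter to be [c.+1]. *)
  have eqx : key_count x (f y c).+1 = key_count x (f y c).
    rewrite key_countS; case: key_letterP => [[d dk e]|]; last by rewrite addn0.
    by case: (f_neq nxy dk ck).
  have eqy : key_count y (f y c) = c.
    apply/eqP; rewrite eqn_leq leqNgt key_countP ltnn andbF /=.
    case: (c) ck => // d dk; rewrite key_countP (ltn_trans (ltnSn d) dk).
    exact: f_incr.
  have ltb : f y c < key_bound.
    by have := ck; rewrite -{1}(key_count_max y) key_countP ck.
  have eqyS : key_count y (f y c).+1 = c.+1.
    rewrite key_countS eqy; case: key_letterP => [_|[]]; first by rewrite addn1.
    by exists c.
  have := C _ (ltnW ltb); have := C _ ltb; rewrite eqx eqy eqyS => h1 h2.
  have eqc : key_count x (f y c) = c.+1 by lia.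
  have : c < key_count x (f y c) by rewrite eqc.
  rewrite key_countP => /andP[_ lt1]; split=> // ck1.
  have : ~~ (c.+1 < key_count x (f y c)) by rewrite eqc ltnn.
  rewrite key_countP ck1 /= -leqNgt leq_eqVlt => /orP[/eqP e|//].
  by case: (f_neq nxy ck1 ck).
(* If the counts at [n] break a bound, the smaller count is itself the index of a copy that
   contradicts [I]. *)
apply/andP; split; rewrite leqNgt; apply/negP => lt.
  have := lt; rewrite key_countP => /andP[ck lt'].
  have := ltnn (key_count x n); rewrite {1}key_countP ck => /negbT/negP; apply.
  by apply: ltn_trans lt'; case: (I _ ck).
have := lt; rewrite key_countP => /andP[ck lt'].
have := ltnn (key_count y n); rewrite {1}key_countP (ltn_trans _ ck) // => /negbT/negP.
by apply; apply: ltn_trans lt'; case: (I _ (ltn_trans (ltnSn _) ck)) => _; apply.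
Qed.

End Keys.

Theorem k_representable_keys (G : sgraph) (k : nat) (f : G -> nat -> nat) :
  0 < k ->
  (forall x c d, c < d -> d < k -> f x c < f x d) ->
  (forall x y c d, x != y -> c < k -> d < k -> f x c <> f y d) ->
  (forall x y : G, x != y ->
     edge x y <-> interleaved k (f x) (f y) \/ interleaved k (f y) (f x)) ->
  k_representable k G.
Proof.
move=> k0 f_incr f_neq f_edge; exists (key_word k f).
have cnt x : count_mem x (key_word k f) = k by exact: key_count_max.
do 2!split=> //.
  by move=> x; rewrite -has_pred1 has_count cnt.
move=> x y nxy; rewrite alternateP // f_edge //.
by rewrite !leads_interleaved // eq_sym.
Qed.

(** * Semi-transitive orientations *)

Section SemiTransitive.
Variables (G : sgraph) (D : rel G) (h : G -> nat).
Hypothesis edgeE : forall x y, edge x y = D x y || D y x.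
Hypothesis h_incr : forall x y, D x y -> h x < h y.
(** No shortcuts: an arc from the first to the last vertex of a directed path forces all arcs along
    it. The height [h] excludes cycles. *)
Hypothesis semi_trans : forall u x y z, connect D u x -> connect D x y ->
  connect D y z -> D u z -> x != y -> D x y.

Lemma connect_h x y : connect D x y -> x != y -> h x < h y.
Proof.
case/connectP => p; elim: p x => [|z p IHp] x /=; first by move=> _ ->; rewrite eqxx.
case/andP=> xz zp e _; apply: leq_trans (h_incr xz) _.
by have [->//|nzy] := eqVneq z y; apply: ltnW; apply: IHp.
Qed.

(* Let (v, i) stand for the copy i of v in a word with two copies of each letter.
   Edges u -> v force (u,0) < (v,0) < (u,1) < (v,1).  If there is a directed path
   from x to y, [downset (x, y)] consists of the copies thereby forced before
   (x,1); semi-transitivity says that (y,0) is not among them, so a word that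
   lists the down-set first contains x x y y.  If x and y are incomparable the
   down-set of (x,0) is used instead, and x precedes y in the first half. *)
Definition downset (q : G * G) (v : G) (i : bool) : bool :=
  if connect D q.1 q.2 then
    if i then connect D v q.1 else
    [exists z, [exists u, [&& connect D v z, (u == z) || D u z & connect D u q.1]]]
  else ~~ i && connect D v q.1.

(** Initial segments of the forced order (u,0) < (v,0) < (u,1) < (v,1) over arcs, together with
    (v,0) < (v,1). *)
Definition down_closed (A : G -> bool -> bool) :=
  (forall v, A v true -> A v false) /\
  (forall u v, D u v -> [/\ A v false -> A u false, A u true -> A v false
                        & A v true -> A u true]).

Lemma downset_closed q : down_closed (downset q).
Proof.
case: q => x y; rewrite /downset /=; case: (connect D x y) => /=; last first.
  split=> // u v uv; split=> //.
  by apply: connect_trans; apply: connect1.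
split=> [v vx|u v uv].
  by apply/existsP; exists v; apply/existsP; exists v; rewrite connect0 eqxx.
split.
- case/existsP=> z /existsP[t /and3P[vz tz tx]]; apply/existsP; exists z.
  apply/existsP; exists t; rewrite tz tx !andbT.
  exact: connect_trans (connect1 uv) vz.
- move=> ux; apply/existsP; exists v; apply/existsP; exists u.
  by rewrite connect0 uv ux orbT.
- by apply: connect_trans; apply: connect1.
Qed.

(** Were (y,0) forced before (x,1), there would be either a cycle through [x] and [y], or an arc
    from [u] to [z] spanning a path through [x] and then [y], a shortcut. *)
Lemma downset_comparable x y : x != y -> ~~ D x y -> connect D x y ->
  downset (x, y) x true && ~~ downset (x, y) y false.
Proof.
move=> nxy nD xy; rewrite /downset /= xy connect0 /=.
apply/existsP => -[z /existsP[u /and3P[yz /orP[/eqP uz|uz] ux]]]; last first.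
  by case/negP: nD; apply: semi_trans ux xy yz uz nxy.
have yx : connect D y x by apply: connect_trans yz _; rewrite -uz.
have := connect_h xy nxy; have := connect_h yx.
by rewrite eq_sym => /(_ nxy); lia.
Qed.

Lemma downset_incomparable x y : ~~ connect D x y -> ~~ connect D y x ->
  downset (x, y) x false && ~~ downset (x, y) y false.
Proof.
by move=> /negbTE nxy nyx; rewrite /downset /= nxy /= connect0.
Qed.

Let H := (\max_v h v).+1.

Lemma h_lt v : h v < H.
Proof. by rewrite ltnS leq_bigmax. Qed.

(** Four layers of width [H]: first copies in [A], second copies in [A], then the same outside [A];
    each layer is sorted topologically by [h]. *)
Definition level (A : G -> bool -> bool) (v : G) (i : bool) : nat :=
  (~~ A v i) * (2 * H) + i * H + h v.

Lemma level_lt A v i : level A v i < 4 * H.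
Proof. by have := h_lt v; rewrite /level; case: (A v i); case: i; lia. Qed.

Lemma level_down (A : G -> bool -> bool) u v i j :
  A u i -> ~~ A v j -> level A u i < level A v j.
Proof.
move=> Au /negbTE Av; have := h_lt u; have := h_lt v; rewrite /level Au Av.
by move: i j {Au Av} => [] []; lia.
Qed.

Lemma level_self A v : down_closed A -> level A v false < level A v true.
Proof.
case=> A1 _; have := h_lt v; have := A1 v; rewrite /level.
by case: (A v true) (A v false) => -[] //= e; try (by have := e isT); lia.
Qed.

Lemma level_edge A u v : down_closed A -> D u v ->
  [/\ level A u false < level A v false, level A v false < level A u true &
      level A u true < level A v true].
Proof.
case=> _ A2 uv; have [a1 a2 a3] := A2 _ _ uv.
have := h_lt u; have := h_lt v; have := h_incr uv.
move: a1 a2 a3; rewrite /level; split.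
- by case: (A u false) (A v false) a1 => -[] //= e; try (by have := e isT); lia.
- by case: (A u true) (A v false) a2 => -[] //= e; try (by have := e isT); lia.
- by case: (A u true) (A v true) a3 => -[] //= e; try (by have := e isT); lia.
Qed.

(* The word has one block of two copies of each letter for every ordered pair q
   of vertices, beginning with the down-set of q. *)
Definition block_set (p : nat) : G -> bool -> bool :=
  nth (fun _ _ => true) [seq downset q | q <- enum {: G * G}] p.

Lemma block_set_closed p : down_closed (block_set p).
Proof.
rewrite /block_set; have [lt|ge] := ltnP p (size (enum {: G * G})); last first.
  by rewrite nth_default // size_map.
case: (enum _) lt => // q s lt.
rewrite (nth_map q) //; exact: downset_closed.
Qed.

Lemma block_set_index q : block_set (index q (enum {: G * G})) = downset q.
Proof. by rewrite /block_set (nth_map q) ?index_mem ?nth_index ?mem_enum. Qed.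

(** Block p holds copies 2p and 2p+1; its width 4H exceeds every level, so blocks do not overlap. *)
Definition block_level (v : G) (c : nat) : nat :=
  c./2 * (4 * H) + level (block_set c./2) v (odd c).

(* Ties between equal levels are broken by [enum_rank]. *)
Definition block_key (v : G) (c : nat) : nat :=
  block_level v c * #|G| + enum_rank v.

Lemma block_key_lt u v c d :
  block_level u c < block_level v d -> block_key u c < block_key v d.
Proof.
move=> lt; rewrite /block_key; apply: (@leq_trans ((block_level u c).+1 * #|G|)).
  by rewrite mulSn addnC ltn_add2r.
by apply: leq_trans (leq_addr _ _); rewrite leq_mul2r lt orbT.
Qed.

Lemma block_level_even v p :
  block_level v p.*2 = p * (4 * H) + level (block_set p) v false.
Proof. by rewrite /block_level doubleK odd_double. Qed.

Lemma block_level_odd v p :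
  block_level v p.*2.+1 = p * (4 * H) + level (block_set p) v true.
Proof. by rewrite /block_level /= uphalf_double odd_double. Qed.

Lemma parity_ind (P : nat -> Prop) :
  (forall p, P p.*2) -> (forall p, P p.*2.+1) -> forall c, P c.
Proof.
move=> P0 P1 c; rewrite -(odd_double_half c).
by case: (odd c); rewrite ?add0n ?add1n.
Qed.

Lemma block_key_edge u v : D u v -> forall c,
  block_key u c < block_key v c /\ block_key v c < block_key u c.+1.
Proof.
move=> uv; elim/parity_ind => p; have [l1 l2 l3] := level_edge (block_set_closed p) uv.
  by split; apply: block_key_lt;
    rewrite -?doubleS ?block_level_even ?block_level_odd ltn_add2l.
split; apply: block_key_lt; first by rewrite !block_level_odd ltn_add2l.
rewrite -doubleS block_level_even block_level_odd mulSn.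
by have := level_lt (block_set p) v true; lia.
Qed.

Lemma block_key_incr v c d : c < d -> block_key v c < block_key v d.
Proof.
apply: (homo_ltn ltn_trans) c d; elim/parity_ind => p; apply: block_key_lt.
  by rewrite block_level_even block_level_odd ltn_add2l; apply/level_self/block_set_closed.
rewrite -doubleS block_level_even block_level_odd mulSn.
by have := level_lt (block_set p) v true; lia.
Qed.

Theorem semi_transitive_representable : exists2 k, 0 < k & k_representable k G.
Proof.
(* The extra block, given the default set of [block_set], keeps the number of copies positive even
   when [G] has no vertex. *)
pose N := size (enum {: G * G}); exists (N.+1).*2 => //.
apply: (@k_representable_keys _ _ block_key) => //.
- by move=> v c d cd _; apply: block_key_incr.
- move=> u v c d nuv _ _ /(congr1 (modn^~ #|G|)).
  rewrite /block_key !modnMDl !modn_small // => /ord_inj/enum_rank_inj e.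
  by rewrite e eqxx in nuv.
(* If a path leads from [x] to [y], block (x,y) contains x x y y; otherwise in block (y,x) the first
   [y] precedes the first [x]. Neither fits [x] leading [y]. *)
have sep x y : x != y -> ~~ edge x y -> ~ interleaved (N.+1).*2 (block_key x) (block_key y).
  move=> nxy; rewrite edgeE negb_or => /andP[nDxy nDyx] I.
  have idx q : index q (enum {: G * G}) < N by rewrite index_mem mem_enum.
  have bnd q : (index q (enum {: G * G})).*2.+1 < (N.+1).*2.
    by have := idx q; lia.
  have [xy|nxy'] := boolP (connect D x y).
    have [_ lt] := I _ (ltnW (bnd (x, y))); have {lt} := lt (bnd (x, y)).
    apply/negP; rewrite -leqNgt; apply/ltnW/block_key_lt.
    rewrite block_level_even block_level_odd ltn_add2l block_set_index.
    by apply: level_down; case/andP: (downset_comparable nxy nDxy xy).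
  have [lt _] := I _ (ltnW (bnd (y, x))).
  apply/negP: lt; rewrite -leqNgt; apply: ltnW; have [yx|nyx] := boolP (connect D y x).
    apply: (ltn_trans (block_key_incr y (ltnSn _))); apply: block_key_lt.
    rewrite block_level_even block_level_odd ltn_add2l block_set_index.
    by apply: level_down; rewrite eq_sym in nxy; case/andP: (downset_comparable nxy nDyx yx).
  apply: block_key_lt; rewrite !block_level_even ltn_add2l block_set_index.
  by apply: level_down; case/andP: (downset_incomparable nyx nxy').
move=> x y nxy; split=> [|I].
  rewrite edgeE => /orP[xy|yx]; [left|right] => c _.
    by have [] := block_key_edge xy c.
  by have [] := block_key_edge yx c.
apply: contraT => ne; case: I => [/(sep _ _ nxy ne) //|/sep I].
by case: I; rewrite 1?eq_sym // edge_sym.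
Qed.

End SemiTransitive.

(** * King graphs with few rows *)

(* The pair (s, q) is the sweep and the offset within it of the copy c of a
   letter in row i and in a column of parity p; even-numbered sweeps run from
   left to right and odd-numbered ones from right to left.  The table was found
   by computer search. *)
Definition king4_slot (i : nat) (p : bool) (c : nat) : nat * nat :=
  let row := match i, p with
    | 0, false => [:: (2, 0); (2, 12); (3, 11)]
    | 1, false => [:: (1, 7); (2, 11); (3, 10)]
    | 2, false => [:: (0, 3); (1, 8); (2, 13)]
    | _, false => [:: (0, 2); (1, 4); (2, 2)]
    | 0, true => [:: (0, 1); (2, 8); (3, 0)]
    | 1, true => [:: (0, 13); (2, 10); (3, 2)]
    | 2, true => [:: (0, 11); (1, 9); (3, 1)]
    | _, true => [:: (0, 0); (0, 12); (1, 10)]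
    end in nth (0, 0) row c.

(** The column is 2t + p, and one step in [t] shifts positions by 7. Offsets are at most 13, so
    sweeps spaced by 7 (n + 4) stay disjoint for [t <= n]. *)
Definition king4_key (n i : nat) (p : bool) (t c : nat) : nat :=
  let: (s, q) := king4_slot i p c in
  s * (7 * (n + 4)) + q + 7 * (if odd s then n - t else t).

Lemma interleaved3 (a b : nat -> nat) : interleaved 3 a b <->
  [&& a 0 < b 0, b 0 < a 1, a 1 < b 1, b 1 < a 2 & a 2 < b 2].
Proof.
split=> [I|/and5P[h1 h2 h3 h4 h5] [|[|[|c]]] //].
have [h1 h2] := I 0 isT; have [h3 h4] := I 1 isT; have [h5 _] := I 2 isT.
by rewrite h1 h2 // h3 h4.
Qed.

Lemma king4_key_incr n i p t c d : i < 4 -> t <= n -> c < d -> d < 3 ->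
  king4_key n i p t c < king4_key n i p t d.
Proof.
move: i p c d => [|[|[|[|i]]]] [] [|[|[|c]]] [|[|[|d]]] //= _ tn _ _;
  rewrite /king4_key /king4_slot /=; lia.
Qed.

(** Sweeps are disjoint, and the table offsets within one sweep are distinct modulo 7. *)
Lemma king4_key_neq n i p t j q u c d : i < 4 -> j < 4 -> t <= n -> u <= n ->
  (i, p, t) != (j, q, u) -> c < 3 -> d < 3 ->
  king4_key n i p t c <> king4_key n j q u d.
Proof.
move=> i4 j4 tn un + c3 d3.
move: i j i4 j4 => [|[|[|[|i]]]] [|[|[|[|j]]]] // _ _; 
move: p q => [] [];
move: c d c3 d3 => [|[|[|c]]] [|[|[|d]]] //= _ _;
  rewrite /king4_key /king4_slot /= ?xpair_eqE /=; lia.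
Qed.
(** The left side is king adjacency. For fixed rows and parities both sides are linear conditions on
    [n], [t] and [u]. *)
Lemma king4_key_interleaved n i (p : bool) t j (q : bool) u :
  i < 4 -> j < 4 -> t <= n -> u <= n -> (i, p, t) != (j, q, u) ->
  [&& i <= j.+1, j <= i.+1, t.*2 + p <= (u.*2 + q).+1 & u.*2 + q <= (t.*2 + p).+1] =
  (let a := king4_key n i p t in let b := king4_key n j q u in
  [&& a 0 < b 0, b 0 < a 1, a 1 < b 1, b 1 < a 2 & a 2 < b 2] ||
  [&& b 0 < a 0, a 0 < b 1, b 1 < a 1, a 1 < b 2 & b 2 < a 2]).
Proof.
move=> + + tn un.
move: i j => [|[|[|[|i]]]] [|[|[|[|j]]]] // _ _;
move: p q => [] []; rewrite /king4_key /king4_slot /= ?xpair_eqE /=; lia.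
Qed.

Lemma king_edgeE m n (u v : King m n) :
  edge u v = [&& u != v, u.1 <= v.1.+1, v.1 <= u.1.+1,
                 u.2 <= v.2.+1 & v.2 <= u.2.+1].
Proof.
rewrite /= /king_edge; congr (_ && _).
have dE (a b : nat) : (`|a - b|%N <= 1) = (a <= b.+1) && (b <= a.+1) by lia.
by rewrite !dE -andbA.
Qed.

Lemma King_neq m n (u v : King m n) :
  (u != v) = ((u.1 : nat) != v.1) || ((u.2 : nat) != v.2).
Proof. by case: u v => [i j] [i' j']; rewrite xpair_eqE negb_and. Qed.

Lemma King4_3_representable n : k_representable 3 (King 4 n).
Proof.
pose f (u : King 4 n) := king4_key n u.1 (odd u.2) (u.2)./2.
have half_le (u : King 4 n) : (u.2)./2 <= n.
  by have := ltn_ord u.2; lia.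
have neq (u v : King 4 n) : u != v ->
    (u.1 : nat, odd u.2, (u.2)./2) != (v.1 : nat, odd v.2, (v.2)./2).
  by rewrite King_neq !xpair_eqE; lia.
apply: (@k_representable_keys _ 3 f) => //.
- by move=> u c d cd d3; apply: king4_key_incr.
- by move=> u v c d nuv c3 d3; apply: king4_key_neq => //; apply: neq.
move=> u v nuv; rewrite !interleaved3 king_edgeE nuv /= /f.
rewrite (rwP orP).
have /= <- := king4_key_interleaved (ltn_ord u.1) (ltn_ord v.1)
  (half_le u) (half_le v) (neq _ _ nuv).
by rewrite !(addnC _.*2) !odd_double_half.
Qed.

Lemma King2_2_representable n : k_representable 2 (King 2 n).
Proof.
(* The second copies of column j fall after the first copies of column j+1 and before those of
   column j+2. *)
pose f (u : King 2 n) c := 4 * u.2 + u.1 + 6 * c.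
have lt2 (u : King 2 n) : u.1 < 2 by [].
apply: (@k_representable_keys _ 2 f) => //.
- by move=> u c d; rewrite /f; lia.
- move=> u v c d; rewrite King_neq /f.
  have := lt2 u; have := lt2 v; lia.
move=> u v nuv; rewrite king_edgeE nuv /=; move: nuv; rewrite King_neq => nuv.
have := lt2 u; have := lt2 v => hv hu.
have I2 (a b : nat -> nat) : interleaved 2 a b <-> [&& a 0 < b 0, b 0 < a 1 & a 1 < b 1].
  split=> [I|/and3P[h1 h2 h3] [|[|[|c]]] //].
  by have [h1 h2] := I 0 isT; have [h3 h4] := I 1 isT; rewrite h1 h2.
rewrite !I2 /f; move: nuv hu hv.
case: u => [[a ha] [b hb]]; case: v => [[a1 ha1] [b1 hb1]] /=; split; lia.
Qed.

(** * Induced subgraphs and 1-uniform words *)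

Lemma induced_k_representable (H G : sgraph) (k : nat) (h : H -> G) :
  injective h -> (forall x y, edge (h x) (h y) = edge x y) ->
  k_representable k G -> k_representable k H.
Proof.
move=> h_inj h_edge [w [[w_all w_alt] w_cnt]].
pose g z := [pick x | h x == z].
have gK : ocancel g h.
  by rewrite /g => z; case: pickP => [x /eqP|].
have hK : pcancel h g.
  move=> x; rewrite /g; case: pickP => [y /eqP/h_inj -> //|/(_ x)].
  by rewrite eqxx.
have cnt x : count_mem x (pmap g w) = count_mem (h x) w.
  elim: w {w_all w_alt w_cnt} => //= z w IHw.
  have := gK z; case gz: (g z) => [y|] /=; rewrite IHw.
    by move=> <-; rewrite (inj_eq h_inj).
  by move=> _; case: eqP gz => // ->; rewrite hK.
exists (pmap g w); split; last by move=> x; rewrite cnt.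
split=> [x|x y nxy]; first by rewrite -has_pred1 has_count cnt -has_count has_pred1.
rewrite -h_edge -w_alt ?(inj_eq h_inj) //.
(* Deleting the letters outside the image of [h] leaves the restriction to two letters of the image
   intact. *)
have fE : [seq h z | z <- pmap g w & (z == x) || (z == y)] =
    [seq z <- w | (z == h x) || (z == h y)].
  elim: w {w_all w_alt w_cnt cnt} => //= z w IHw.
  have := gK z; case gz: (g z) => [u|] /=.
    by move=> <-; rewrite !(inj_eq h_inj); case: ifP => _ //=; rewrite IHw.
  move=> _; rewrite IHw; case: eqP gz => [->|_]; first by rewrite hK.
  by case: eqP => [->|//]; rewrite hK.
rewrite /alternate /= -fE; split=> -[n b]; exists n.
  by case: b => ->; rewrite map_altword; [left|right].
by move: b; rewrite -!map_altword => -[] /(inj_map h_inj) ->; [left|right].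
Qed.

Lemma complete_of_1_representable (G : sgraph) (x y : G) :
  k_representable 1 G -> x != y -> edge x y.
Proof.
move=> [w [[w_all w_alt] w_cnt]] nxy; apply/(w_alt x y nxy).
set w' := [seq z <- w | (z == x) || (z == y)].
have : perm_eq w' [:: x; y].
  apply: uniq_perm; last 1 first.
  - by move=> z; rewrite mem_filter w_all andbT !inE.
  - apply: filter_uniq; apply: count_mem_uniq => z.
    by rewrite w_all w_cnt.
  - by rewrite /= inE nxy.
move=> pw; exists 2; rewrite /= -/w'.
have -> : altword x y 2 = [:: x; y] by [].
have -> : altword y x 2 = [:: y; x] by [].
have := perm_size pw; case: w' pw => [|a [|b [|]]] // pw _.
have au : a != b by have := perm_uniq pw; rewrite /= !inE nxy !andbT.
have /orP : (a == x) || (a == y).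
  by have := perm_mem pw a; rewrite !inE eqxx.
have : (b == x) || (b == y).
  by have := perm_mem pw b; rewrite !inE eqxx orbT.
move=> /orP[]/eqP eb []/eqP ea; subst; rewrite ?eqxx // in au *; by [left|right].
Qed.

Lemma King_swap_representable m n k :
  k_representable k (King m n) -> k_representable k (King n m).
Proof.
apply: (@induced_k_representable _ _ _ (fun u : King n m => (u.2, u.1) : King m n)).
  by move=> [i j] [i' j'] [-> ->].
move=> [i j] [i' j']; rewrite !king_edgeE !xpair_eqE /=; lia.
Qed.

Lemma King_widen_representable m n m' n' k : m <= m' -> n <= n' ->
  k_representable k (King m' n') -> k_representable k (King m n).
Proof.
move=> le_m le_n; apply: (@induced_k_representable _ _ _
  (fun u : King m n => (widen_ord le_m u.1, widen_ord le_n u.2) : King m' n')).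
  by move=> [i j] [i' j'] [/ord_inj -> /ord_inj ->].
by move=> [i j] [i' j']; rewrite !king_edgeE !King_neq.
Qed.

Lemma King_not_1_representable m n : 0 < m -> 2 < n ->
  ~ k_representable 1 (King m n).
Proof.
move=> m0 n2 R; have n0 : 0 < n by apply: leq_trans n2.
pose x : King m n := (Ordinal m0, Ordinal n0).
pose y : King m n := (Ordinal m0, Ordinal n2).
have nxy : x != y by rewrite King_neq.
by have := complete_of_1_representable R nxy; rewrite king_edgeE nxy.
Qed.

Lemma King22_1_representable : k_representable 1 (King 2 2).
Proof.
(* The four cells are pairwise adjacent, so any injective numbering serves. *)
pose f (u : King 2 2) (c : nat) := u.1 + 2 * u.2.
apply: (@k_representable_keys _ 1 f) => //; rewrite /f.
- by move=> u [|c] [|d].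
- move=> u v c d; rewrite King_neq.
  have : u.1 < 2 by []. have : v.1 < 2 by [].
  by move=> ? ? ? _ _; lia.
move=> u v nuv; rewrite king_edgeE nuv.
have : u.1 < 2 by []. have : v.1 < 2 by [].
have : u.2 < 2 by []. have : v.2 < 2 by [].
move: nuv; rewrite King_neq => nuv h1 h2 h3 h4; split=> [_|_]; last lia.
have [lt|ge] := ltnP (u.1 + 2 * u.2) (v.1 + 2 * v.2).
  by left=> -[|c].
by right=> -[|c] // _; split=> //; lia.
Qed.

(** * Exhaustive search for 2-uniform words *)

(** The length quantified in [alternate] can only be that of the restricted word, which makes the
    test computable. *)
Definition alternateb (T : eqType) (x y : T) (w : seq T) : bool :=
  let w' := [seq z <- w | (z == x) || (z == y)] in
  (w' == altword x y (size w')) || (w' == altword y x (size w')).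

Lemma alternatebP (T : eqType) (x y : T) (w : seq T) :
  reflect (alternate x y w) (alternateb x y w).
Proof.
apply: (iffP orP) => [[]/eqP e|[n [] e]].
- by exists (size [seq z <- w | (z == x) || (z == y)]); left.
- by exists (size [seq z <- w | (z == x) || (z == y)]); right.
- by left; rewrite e size_altword.
- by right; rewrite e size_altword.
Qed.

Lemma alternateb_map (S T : eqType) (h : S -> T) (x y : S) (w : seq S) :
  injective h -> alternateb (h x) (h y) (map h w) = alternateb x y w.
Proof.
move=> h_inj; rewrite /alternateb filter_map size_map.
rewrite -!map_altword !(inj_eq (inj_map h_inj)).
suff -> : [seq z <- w | preim h (fun z => (z == h x) || (z == h y)) z] =
  [seq z <- w | (z == x) || (z == y)] by [].
by apply: eq_filter => z /=; rewrite !(inj_eq h_inj).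
Qed.

Fixpoint insert1 (T : Type) (a : T) (s : seq T) : seq (seq T) :=
  (a :: s) :: if s is x :: s' then map (cons x) (insert1 a s') else [::].

Fixpoint insert2 (T : Type) (a : T) (s : seq T) : seq (seq T) :=
  map (cons a) (insert1 a s) ++
  if s is x :: s' then map (cons x) (insert2 a s') else [::].

Section Insert.
Variables (T : eqType) (a : T).

Lemma mem_insert1 (s : seq T) :
  count_mem a s = 1 -> s \in insert1 a [seq z <- s | z != a].
Proof.
elim: s => //= z s IHs; case: (eqVneq z a) => [->|nza] /= c.
  have -> : [seq z <- s | z != a] = s.
    by apply/all_filterP; rewrite all_predC has_count; case: c; rewrite add0n => ->.
  by case: s {IHs c} => [|? ?]; rewrite inE eqxx.
by rewrite inE map_f ?orbT // IHs.
Qed.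

Lemma mem_insert2 (s : seq T) :
  count_mem a s = 2 -> s \in insert2 a [seq z <- s | z != a].
Proof.
have insert2E t : insert2 a t = map (cons a) (insert1 a t) ++
    (if t is x :: t' then map (cons x) (insert2 a t') else [::]) by case: t.
elim: s => //= z s IHs; case: (eqVneq z a) => [->|nza] /= c.
  by rewrite insert2E mem_cat map_f // mem_insert1 //; case: c.
by rewrite inE mem_cat (map_f (cons z)) ?orbT // IHs.
Qed.

End Insert.

(** Inserting [k'] leaves the older pairs unaffected, so only pairs with the new letter are
    tested. *)
Fixpoint representants (adj : rel nat) (k : nat) : seq (seq nat) :=
  if k is k'.+1 then
    [seq s <- flatten [seq insert2 k' s | s <- representants adj k'] |
       all (fun a => alternateb a k' s == adj a k') (iota 0 k')]
  else [:: [::]].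

Lemma mem_representants (adj : rel nat) (w : seq nat) (k : nat) :
  (forall a, a < k -> count_mem a w = 2) ->
  (forall a b, a < b < k -> alternateb a b w = adj a b) ->
  [seq z <- w | z < k] \in representants adj k.
Proof.
elim: k => [|k IHk] cnt alt; first by rewrite filter_pred0.
rewrite mem_filter; apply/andP; split.
  apply/allP => a; rewrite mem_iota add0n => /andP[_ ak].
  rewrite -alt ?ak //= /alternateb -filter_predI.
  suff -> : [seq z <- w | predI (fun z => (z == a) || (z == k)) (ltn^~ k.+1) z] =
    [seq z <- w | (z == a) || (z == k)] by [].
  by apply: eq_filter => z /=; lia.
apply/flatten_mapP; exists [seq z <- w | z < k].
  by apply: IHk => [a ak|a b /andP[ab bk]]; [apply: cnt|apply: alt]; lia.
(* The shorter restriction is the longer one without its two copies of [k], so [insert2] recovers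
   the latter. *)
have -> : [seq z <- w | z < k] = [seq z <- [seq z <- w | z < k.+1] | z != k].
  by rewrite -filter_predI; apply: eq_filter => z /=; lia.
apply: mem_insert2; rewrite count_filter -(cnt k (ltnSn k)).
by apply: eq_count => z /=; lia.
Qed.

(* The centre, the middles of the four sides and two corners; this order keeps
   the search small. *)
Definition king33_pos (a : nat) : nat * nat :=
  nth (0, 0) [:: (1, 1); (0, 1); (2, 1); (1, 2); (1, 0); (0, 2); (0, 0)] a.

Definition king33_adj (a b : nat) : bool :=
  let: (i, j) := king33_pos a in let: (i', j') := king33_pos b in
  [&& i <= i'.+1, i' <= i.+1, j <= j'.+1 & j' <= j.+1].

Lemma representants_king33 : representants king33_adj 7 = [::].
Proof. by vm_compute. Qed.

Definition king33_edge : rel 'I_7 := fun a b => (a != b) && king33_adj a b.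

Lemma king33_edge_sym : symmetric king33_edge.
Proof.
move=> a b; rewrite /king33_edge eq_sym /king33_adj; congr (_ && _).
by case: (king33_pos a) (king33_pos b) => [i j] [i' j']; lia.
Qed.

Lemma king33_edge_irrefl : irreflexive king33_edge.
Proof. by move=> a; rewrite /king33_edge eqxx. Qed.

Definition king33_part := SGraph king33_edge_sym king33_edge_irrefl.

Lemma king33_part_not_2_representable : ~ k_representable 2 king33_part.
Proof.
move=> [w [[_ w_alt] w_cnt]].
have : [seq z <- map val w | z < 7] \in representants king33_adj 7.
  apply: mem_representants => [a a7|a b /andP[ab b7]].
    apply: etrans (w_cnt (Ordinal a7)); rewrite count_map.
    exact: eq_count.
  pose x : king33_part := Ordinal (ltn_trans ab b7).
  pose y : king33_part := Ordinal b7.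
  have nxy : x != y by rewrite -val_eqE /= neq_ltn ab.
  rewrite (alternateb_map x y w val_inj).
  by apply/alternatebP/idP => [/(w_alt x y nxy)/andP[]|e] //; apply/(w_alt x y nxy)/andP.
by rewrite representants_king33.
Qed.

(** Past the list, the default (0, 0) also lies on the board. *)
Lemma king33_pos_lt a : ((king33_pos a).1 < 3) && ((king33_pos a).2 < 3).
Proof. by do 8?[case: a => [|a] //]. Qed.

Lemma king33_pos_inj (a b : nat) : a < 7 -> b < 7 ->
  king33_pos a = king33_pos b -> a = b.
Proof. by do 7?[case: a => [|a]]; do 7?[case: b => [|b]]. Qed.

Lemma King_not_2_representable m n : 2 < m -> 2 < n ->
  ~ k_representable 2 (King m n).
Proof.
move=> m2 n2 R; apply: king33_part_not_2_representable.
pose h (a : 'I_7) : King 3 3 := (inord (king33_pos a).1, inord (king33_pos a).2).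
have hE a : ((h a).1 : nat, (h a).2 : nat) = king33_pos a.
  by have /andP[lt1 lt2] := king33_pos_lt a; rewrite !inordK -?surjective_pairing.
have h_inj : injective h.
  move=> a b e; apply/val_inj/king33_pos_inj; try exact: ltn_ord.
  by rewrite -!hE e.
apply: induced_k_representable (King_widen_representable m2 n2 R) => //.
  exact: h_inj.
move=> a b; rewrite king_edgeE (inj_eq h_inj).
suff : king33_edge a b = (a != b) &&
  [&& (h a).1 <= (h b).1.+1, (h b).1 <= (h a).1.+1,
      (h a).2 <= (h b).2.+1 & (h b).2 <= (h a).2.+1] by move=> <-.
by rewrite /king33_edge /king33_adj -(hE a) -(hE b).
Qed.

(** * Representation numbers of king graphs *)

Definition king_colour m n (u : King m n) : nat :=
  if odd u.1 then (if odd u.2 then 2 else 3) else odd u.2.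

Definition king_arc m n : rel (King m n) :=
  fun u v => edge u v && (king_colour u < king_colour v).

Lemma connect_cases (T : finType) (D : rel T) x y : connect D x y ->
  [\/ x = y, D x y | exists z, D x z /\ connect D z y /\ z != y].
Proof.
case/connectP => -[|z p] /=; first by move=> _ ->; constructor 1.
case/andP=> xz zp e; have [zy|nzy] := eqVneq z y.
  by constructor 2; rewrite -zy.
constructor 3; exists z; split=> //; split=> //.
by apply/connectP; exists p.
Qed.

(** Adjacent cells with rows or columns of equal parity share that row or column: i0 = i1, j1 = j2,
    i2 = i3 and j0 = j3, a 2 x 2 square. *)
Lemma king_square_clique i0 j0 i1 j1 i2 j2 i3 j3 :
  ~~ odd i0 -> ~~ odd j0 -> ~~ odd i1 -> odd j1 ->
  odd i2 -> odd j2 -> odd i3 -> ~~ odd j3 ->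
  let adj i j i' j' := [&& i <= i'.+1, i' <= i.+1, j <= j'.+1 & j' <= j.+1] in
  adj i0 j0 i1 j1 -> adj i1 j1 i2 j2 -> adj i2 j2 i3 j3 -> adj i0 j0 i3 j3 ->
  adj i0 j0 i2 j2 && adj i1 j1 i3 j3.
Proof. move=> /=; lia. Qed.

Lemma king_arc_semi_transitive m n (u x y z : King m n) :
  connect (@king_arc m n) u x -> connect (@king_arc m n) x y ->
  connect (@king_arc m n) y z -> king_arc u z -> x != y -> king_arc x y.
Proof.
have colour_lt3 (v : King m n) : king_colour v <= 3.
  by rewrite /king_colour; case: ifP; case: (odd v.2).
have incr (v w : King m n) : king_arc v w -> king_colour v < king_colour w.
  by case/andP.
have clique (a b c d : King m n) : king_arc a b -> king_arc b c ->
    king_arc c d -> king_arc a d -> king_arc a c && king_arc b d.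
  move=> ab bc cd ad; have := incr _ _ ab; have := incr _ _ bc.
  have := incr _ _ cd; have := colour_lt3 d => d3 lcd lbc lab.
  have [a0 b1 c2 d3'] : [/\ king_colour a = 0, king_colour b = 1,
    king_colour c = 2 & king_colour d = 3] by split; lia.
  rewrite /king_arc a0 b1 c2 d3' !andbT.
  have edge_near (v w : King m n) : king_arc v w -> [&& v.1 <= w.1.+1,
      w.1 <= v.1.+1, v.2 <= w.2.+1 & w.2 <= v.2.+1].
    by case/andP; rewrite king_edgeE => /andP[].
  have := king_square_clique _ _ _ _ _ _ _ _ (edge_near _ _ ab)
    (edge_near _ _ bc) (edge_near _ _ cd) (edge_near _ _ ad).
  have neq (v w : King m n) : king_colour v != king_colour w -> v != w.
    by apply: contraNneq => ->.
  have nac : a != c by apply: neq; rewrite a0 c2.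
  have nbd : b != d by apply: neq; rewrite b1 d3'.
  rewrite !king_edgeE nac nbd.
  have odd1 (v : King m n) : odd v.1 = (2 <= king_colour v).
    by rewrite /king_colour; case: (odd v.1); case: (odd v.2).
  have odd2 (v : King m n) : odd v.2 = (king_colour v \in [:: 1; 2]).
    by rewrite /king_colour; case: (odd v.1); case: (odd v.2).
  by rewrite !odd1 !odd2 a0 b1 c2 d3'; apply.
have no_chain (a b c d e : King m n) : king_colour a < king_colour b ->
    king_colour b < king_colour c -> king_colour c < king_colour d ->
    king_colour d < king_colour e -> False.
  by move=> ab bc cd de; have := colour_lt3 e; move: ab bc cd de; clear; lia.
move=> ux xy yz uz nxy; case: (connect_cases xy) => [e|//|[a [xa [ay nay]]]].
  by rewrite e eqxx in nxy.
have lxa := incr _ _ xa; have lay := connect_h incr ay nay.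
(* Without an arc from [a] to [y], the path from [x] to [y] already uses all four colours, so
   [u = x] and [y = z]. *)
have [ayD|nayD] := boolP (king_arc a y); last first.
  case: (connect_cases ay) => [e|ayD|[b [ab [b_y nby]]]].
  - by rewrite e eqxx in nay.
  - by rewrite ayD in nayD.
  have lab := incr _ _ ab; have lby := connect_h incr b_y nby.
  have [ez|nyz] := eqVneq y z; last first.
    by case: (no_chain _ _ _ _ _ lxa lab lby (connect_h incr yz nyz)).
  have [ex|nux] := eqVneq u x; first by rewrite -ex ez.
  by case: (no_chain _ _ _ _ _ (connect_h incr ux nux) lxa lab lby).
(* The path through [x], [a], [y] has room for at most one more vertex, at either end; with it,
   [clique] applies. *)
case: (connect_cases ux) => [ex|uxD|[b [ub [bx nbx]]]].
- case: (connect_cases yz) => [ez|yzD|[b [yb [bz nbz]]]].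
  + by rewrite -ex ez.
  + by rewrite ex in uz; case/andP: (clique _ _ _ _ xa ayD yzD uz).
  + by case: (no_chain _ _ _ _ _ lxa lay (incr _ _ yb) (connect_h incr bz nbz)).
- have lux := incr _ _ uxD; have [ez|nyz] := eqVneq y z.
    by rewrite -ez in uz; case/andP: (clique _ _ _ _ uxD xa ayD uz).
  by case: (no_chain _ _ _ _ _ lux lxa lay (connect_h incr yz nyz)).
- by case: (no_chain _ _ _ _ _ (incr _ _ ub) (connect_h incr bx nbx) lxa lay).
Qed.

Lemma King_k_representable m n : exists2 k, 0 < k & k_representable k (King m n).
Proof.
apply: (@semi_transitive_representable _ (@king_arc m n) (@king_colour m n)).
- move=> u v; rewrite /king_arc (edge_sym v u) -andb_orr.
  rewrite king_edgeE King_neq /king_colour; apply/idP/idP => [E|/andP[] //].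
  rewrite E /=; move: u v E => [[i ?] [j ?]] [[i' ?] [j' ?]] /=.
  by case Ei: (odd i); case Ej: (odd j); case Ei': (odd i'); case Ej': (odd j') => //=; lia.
- by move=> u v /andP[].
- exact: king_arc_semi_transitive.
Qed.

Lemma representation_number_not_None (G : sgraph) (k : nat) :
  0 < k -> k_representable k G -> representation_number G <> None.
Proof.
move=> k0 R; rewrite /representation_number; case: boolp.pselect => // -[].
by exists k; rewrite k0; apply/boolp.asboolP.
Qed.

Theorem mainTheorem2 :
  (forall m n : nat, 1 <= m -> 1 <= n ->
     representation_number (King m n) <> None) /\
  (forall m n : nat, m \in [:: 1; 2] -> n \in [:: 1; 2] ->
     representation_number (King m n) = Some 1) /\
  (forall m n : nat, m \in [:: 1; 2] -> 3 <= n ->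
     representation_number (King m n) = Some 2) /\
  (forall m n : nat, m \in [:: 3; 4] -> n \in [:: 1; 2] ->
     representation_number (King m n) = Some 2) /\
  (forall m n : nat, m \in [:: 3; 4] -> 3 <= n ->
     representation_number (King m n) = Some 3).
Proof.
have narrow m n : 0 < m -> m <= 2 -> 3 <= n ->
    representation_number (King m n) = Some 2.
  move=> m0 m2 n3; apply/representation_numberP; split=> // [|[|[|j]] // _ R].
    exact: King_widen_representable m2 (leqnn n) (King2_2_representable n).
  by case: (King_not_1_representable m0 n3 R).
split=> [m n _ _|].
  have [k k0 R] := King_k_representable m n.
  exact: representation_number_not_None k0 R.
split=> [m n|].
  rewrite !inE => hm hn; apply/representation_numberP; split=> //.
  by apply: King_widen_representable King22_1_representable; lia.
split=> [m n|]; first by rewrite !inE => hm; apply: narrow; lia.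
split=> [m n|m n]; rewrite !inE => hm.
  (* Transposing the board reduces this case to [narrow]. *)
  move=> hn; have : representation_number (King n m) = Some 2.
    by apply: narrow; lia.
  case/representation_numberP => _ R R'; apply/representation_numberP; split=> //.
    exact: King_swap_representable.
  by move=> j j1 /King_swap_representable; apply: R'.
move=> n3; apply/representation_numberP; split=> // [|[|[|[|j]]] // _ R].
- by apply: King_widen_representable (King4_3_representable n); lia.
- by case: (@King_not_1_representable m n _ _ R); lia.
- by case: (@King_not_2_representable m n _ _ R); lia.
Qed.
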